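(* Let $G=(V,\sigma,\mu)$ be a fuzzy graph of order $p$. Then $$2\cdot\min\{\mu(u,v):u,v\in V,\ u\neq v\}\ \le\ \gamma_{snR}(G)\ \le\ p-\max_{v\in V}\left\{d_{SN}(v)-\sigma(v)\right\},$$ where the minimum on the left is read as $0$ if $|V|=1$.
   Context: A fuzzy graph $G=(V,\sigma,\mu)$ consists of a finite nonempty set $V$, a function $\sigma:V\to[0,1]$, and a symmetric function $\mu:V\times V\to[0,1]$ with $\mu(x,x)=0$ and $\mu(x,y)\le \min\{\sigma(x),\sigma(y)\}$ for all $x,y\in V$. Its order is $p=\sum_{x\in V}\sigma(x)$. An edge is an unordered pair $(u,v)$ of distinct vertices with $\mu(u,v)>0$, and $\mu(u,v)$ is its weight. The strength of a path $x_0,x_1,\ldots,x_m$ (with every $\mu(x_{i-1},x_i)>0$) is $\min_i \mu(x_{i-1},x_i)$, and $CONN_G(u,v)$ is the maximum strength of all $u$–$v$ paths. An edge $(u,v)$ is strong if $\mu(u,v)=CONN_G(u,v)$; then $u,v$ are strong neighbors. $N_s(u)$ is the set of strong neighbors of $u$. The strong neighborhood degree of $u$ is $d_{SN}(u)=\sum_{v\in N_s(u)}\sigma(v)$. Put $\mu_s(u)=\min\{\mu(u,v):v\in N_s(u)\}$, with $\mu_s(u)=0$ if $N_s(u)=\emptyset$. A strong-neighbors Roman dominating function (SNRDF) on $G$ is a function $f:V\to\{0,1,2\}$ such that every $u$ with $f(u)=0$ has some $v\in N_s(u)$ with $f(v)=2$. Its weight is $w(f)=\sum_{u\in V}f(u)\mu_s(u)$,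 and $\gamma_{snR}(G)$ is the minimum weight of an SNRDF on $G$. *)

(* Defs.v *)
From HB Require Import structures.
From mathcomp Require Import all_boot all_order all_algebra.
From mathcomp Require Import reals.

Set Implicit Arguments.
Unset Strict Implicit.
Unset Printing Implicit Defensive.

Import Order.TTheory GRing.Theory Num.Theory.
Local Open Scope ring_scope.

(* Minimum and maximum of a finite list of reals, 0 for the empty list. *)
Definition seq_min (R : realType) (s : seq R) : R :=
  if s is x :: s' then foldr Num.min x s' else 0.

Definition seq_max (R : realType) (s : seq R) : R :=
  if s is x :: s' then foldr Num.max x s' else 0.

Lemma seq_min_mem (R : realType) (s : seq R) : s != [::] -> seq_min s \in s.
Proof.
case: s => // x s _ /=; elim: s => [|y s IHs] /=; first exact: mem_head.
rewrite minElt; case: ifP => _; first by rewrite !inE eqxx orbT.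
by move: IHs; rewrite !inE => /orP[->|->] //; rewrite !orbT.
Qed.

Lemma seq_min_le (R : realType) (s : seq R) (y : R) :
  y \in s -> seq_min s <= y.
Proof.
case: s => // x s /=; elim: s => [|z s IHs] /=; rewrite !inE ?ge_min.
  by move/eqP->.
move=> ysz; apply/orP; move: ysz IHs; rewrite !inE.
by case/or3P=> [yx|/eqP->|ys] IHs; [right; apply: IHs | left |
  right; apply: IHs]; rewrite ?yx ?ys ?orbT.
Qed.

Lemma seq_max_mem (R : realType) (s : seq R) : s != [::] -> seq_max s \in s.
Proof.
case: s => // x s _ /=; elim: s => [|y s IHs] /=; first exact: mem_head.
rewrite maxElt; case: ifP => _; last by rewrite !inE eqxx orbT.
by move: IHs; rewrite !inE => /orP[->|->] //; rewrite !orbT.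
Qed.

Lemma seq_max_ge (R : realType) (s : seq R) (y : R) :
  y \in s -> y <= seq_max s.
Proof.
case: s => // x s /=; elim: s => [|z s IHs] /=; rewrite !inE ?le_max.
  by move/eqP->.
move=> ysz; apply/orP; move: ysz IHs; rewrite !inE.
by case/or3P=> [yx|/eqP->|ys] IHs; [right; apply: IHs | left |
  right; apply: IHs]; rewrite ?yx ?ys ?orbT.
Qed.

Record fuzzy_graph (R : realType) (V : finType) := FuzzyGraph {
  fg_sigma : V -> R;
  fg_mu : V -> V -> R;
  fg_nonempty : (0 < #|V|)%N;
  fg_sigma_01 : forall x, 0 <= fg_sigma x <= 1;
  fg_mu_01 : forall x y, 0 <= fg_mu x y <= 1;
  fg_mu_sym : forall x y, fg_mu x y = fg_mu y x;
  fg_mu_irr : forall x, fg_mu x x = 0;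
  fg_mu_le : forall x y, fg_mu x y <= Num.min (fg_sigma x) (fg_sigma y)
}.

Section FuzzyGraph.
Variables (R : realType) (V : finType) (G : fuzzy_graph R V).
Local Notation sigma := (fg_sigma G).
Local Notation mu := (fg_mu G).

Definition fg_order : R := \sum_(x : V) sigma x.

Definition fg_edge : rel V := [rel u v | (u != v) && (0 < mu u v)].

(* The path u = x_0, x_1, ..., x_m = v is encoded by the list
   p = [:: x_1; ...; x_m].  Its vertices are distinct, so m < #|V| and
   the bounded sequences of length at most #|V| include all paths. *)
Definition is_fpath (u v : V) (p : seq V) : bool :=
  [&& path fg_edge u p, last u p == v & uniq (u :: p)].

Definition strength (u : V) (p : seq V) : R := seq_min (pairmap mu u p).

Definition CONN (u v : V) : R :=
  seq_max [seq strength u p |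
             p : #|V|.-bseq V in [pred p : #|V|.-bseq V | is_fpath u v p]].

Definition strong_edge (u v : V) : bool :=
  fg_edge u v && (mu u v == CONN u v).

Definition Ns (u : V) : {set V} := [set v | strong_edge u v].

Definition d_SN (u : V) : R := \sum_(v in Ns u) sigma v.

Definition mu_s (u : V) : R := seq_min [seq mu u v | v in Ns u].

Definition is_SNRDF (f : {ffun V -> 'I_3}) : bool :=
  [forall u, (f u == 0%N :> nat) ==> [exists v in Ns u, f v == 2%N :> nat]].

Definition SNRDF_weight (f : {ffun V -> 'I_3}) : R :=
  \sum_(u : V) (f u)%:R * mu_s u.

Definition gamma_snR : R :=
  seq_min [seq SNRDF_weight f | f in is_SNRDF].

End FuzzyGraph.

(* Main.v *)
Require Import Defs.
From mathcomp Require Import all_boot all_order all_algebra.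
From mathcomp Require Import reals.

(** Upper bound: for a vertex [v], assign 2 to [v], 0 to its strong neighbors
    and 1 elsewhere, and use [mu_s <= sigma].  Lower bound: let [m] be the
    minimal weight over pairs; [mu_s >= m] at every vertex with a strong
    neighbor.  If an SNRDF takes the value 0, it takes the value 2 at a vertex
    with a strong neighbor; otherwise it is at least 1 everywhere, in particular
    at both ends of an edge of maximal weight, and such an edge is strong. *)

Set Implicit Arguments.
Unset Strict Implicit.
Unset Printing Implicit Defensive.

Import Order.TTheory GRing.Theory Num.Theory.
Local Open Scope ring_scope.

Lemma seq_min_ge (R : realType) (s : seq R) (c : R) :
  s != [::] -> (forall y, y \in s -> c <= y) -> c <= seq_min s.
Proof. by move=> /seq_min_mem s_min; apply. Qed.

Lemma seq_min_ge0 (R : realType) (s : seq R) :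
  (forall y, y \in s -> 0 <= y) -> 0 <= seq_min s.
Proof. by case: s => // x s; apply: seq_min_ge. Qed.

Lemma seq_max_le (R : realType) (s : seq R) (c : R) :
  0 <= c -> (forall y, y \in s -> y <= c) -> seq_max s <= c.
Proof. by case: s => // x s _; apply; apply: seq_max_mem. Qed.

Lemma seq_min_rev (R : realType) (s : seq R) : seq_min (rev s) = seq_min s.
Proof.
have [->//|s0] := eqVneq s [::].
have rs0 : rev s != [::] by rewrite -size_eq0 size_rev size_eq0.
apply/le_anti/andP; split; apply: seq_min_le.
  by rewrite mem_rev seq_min_mem.
by rewrite -mem_rev seq_min_mem.
Qed.

Lemma last_rev_belast (T : Type) (x : T) (p : seq T) :
  last (last x p) (rev (belast x p)) = x.
Proof. by case: p => //= y p; rewrite rev_cons last_rcons. Qed.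

(** The path [x :: p] read backwards starts at [last x p] and continues with [rev (belast x p)]; a
    symmetric [f] sees the same steps in reverse order. *)
Lemma pairmap_rev (T S : Type) (f : T -> T -> S) (x : T) (p : seq T) :
  (forall y z, f y z = f z y) ->
  pairmap f (last x p) (rev (belast x p)) = rev (pairmap f x p).
Proof.
move=> fC; elim: p x => //= y p IHp x.
rewrite !rev_cons -!cats1 pairmap_cat IHp /= fC; congr (_ ++ [:: f _ _]).
exact: last_rev_belast.
Qed.

Section FuzzyGraphTheory.
Variables (R : realType) (V : finType) (G : fuzzy_graph R V).
Implicit Types (u v : V) (p : seq V) (f : {ffun V -> 'I_3}).
Local Notation sigma := (fg_sigma G).
Local Notation mu := (fg_mu G).

Lemma fg_mu_ge0 u v : 0 <= mu u v.
Proof. by case/andP: (fg_mu_01 G u v). Qed.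

Lemma fg_sigma_ge0 u : 0 <= sigma u.
Proof. by case/andP: (fg_sigma_01 G u). Qed.

Lemma fg_mu_le_sigma u v : mu u v <= sigma u.
Proof. by have := fg_mu_le G u v; rewrite le_min => /andP[]. Qed.

Lemma CONN_ge u v p : is_fpath G u v p -> strength G u p <= CONN G u v.
Proof.
move=> uvp; have szp : (size p <= #|V|)%N.
  (* The vertices of [u :: p] are distinct, so [p] is short enough to be one of the bounded
     sequences in [CONN]. *)
  case/and3P: uvp => _ _ /card_uniqP /= szp.
  by rewrite ltnW // -szp max_card.
by apply/seq_max_ge/imageP; exists (Bseq szp).
Qed.

(** The bound [0 <= c] covers the case of no path, where [CONN] takes the default 0. *)
Lemma CONN_le u v (c : R) :
    0 <= c -> (forall p, is_fpath G u v p -> strength G u p <= c) ->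
  CONN G u v <= c.
Proof.
by move=> c_ge0 le_c; apply: seq_max_le => // _ /imageP[p uvp ->]; apply: le_c.
Qed.

Lemma CONN_ge_edge u v : fg_edge G u v -> mu u v <= CONN G u v.
Proof.
move=> uv; apply: (@CONN_ge u v [:: v]).
by rewrite /is_fpath /= uv eqxx inE; case/andP: uv => ->.
Qed.

Lemma CONN_ge0 u v : 0 <= CONN G u v.
Proof.
rewrite /CONN; set s := [seq _ | _ in _].
have [->//|/seq_max_mem /imageP[p _ ->]] := eqVneq s [::].
apply: seq_min_ge0; elim: (p : seq V) u {s} => //= y q IHq u z.
by rewrite inE => /predU1P[->|/IHq//]; apply: fg_mu_ge0.
Qed.

Lemma fg_edge_sym u v : fg_edge G u v = fg_edge G v u.
Proof. by rewrite /fg_edge /= eq_sym fg_mu_sym. Qed.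

Lemma is_fpath_rev u v p :
  is_fpath G u v p -> is_fpath G v u (rev (belast u p)).
Proof.
case/and3P=> up /eqP <- uniq_p; rewrite /is_fpath last_rev_belast eqxx.
rewrite rev_path (eq_path (e' := fg_edge G)) ?up; last first.
  by move=> x y; apply: fg_edge_sym.
by rewrite -rev_rcons -lastI rev_uniq.
Qed.

Lemma strength_rev u v p :
  is_fpath G u v p -> strength G v (rev (belast u p)) = strength G u p.
Proof.
case/and3P=> _ /eqP <- _.
by rewrite /strength pairmap_rev ?seq_min_rev //; apply: fg_mu_sym.
Qed.

(** Reversal turns paths from [x] to [y] into paths from [y] to [x] of the same strength. *)
Lemma CONN_sym u v : CONN G u v = CONN G v u.
Proof.
suff le_sym x y : CONN G x y <= CONN G y x by apply/le_anti; rewrite !le_sym.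
apply: CONN_le (CONN_ge0 _ _) _ => p xyp.
by rewrite -(strength_rev xyp); apply/CONN_ge/is_fpath_rev.
Qed.

Lemma Ns_sym u v : (u \in Ns G v) = (v \in Ns G u).
Proof. by rewrite !inE /strong_edge fg_edge_sym fg_mu_sym CONN_sym. Qed.

Lemma Ns_irr u : u \notin Ns G u.
Proof. by rewrite inE /strong_edge /fg_edge /= eqxx. Qed.

Lemma max_edge_strong u v :
  0 < mu u v -> (forall x y, mu x y <= mu u v) -> v \in Ns G u.
Proof.
move=> uv_gt0 uv_max.
have uv : fg_edge G u v.
  by rewrite /fg_edge /= uv_gt0 andbT; apply: contraTneq uv_gt0 => ->;
    rewrite fg_mu_irr ltxx.
rewrite inE /strong_edge uv eq_le CONN_ge_edge //=.
(* The empty path has strength 0 by default; any other path is at most as strong as its first edge,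
   whose weight is at most the maximal one. *)
apply: CONN_le => [|[|y p] _]; rewrite ?fg_mu_ge0 //.
by apply: le_trans (uv_max u y); apply: seq_min_le; rewrite mem_head.
Qed.

Lemma mu_s_ge0 u : 0 <= mu_s G u.
Proof. by apply: seq_min_ge0 => _ /imageP[v _ ->]; apply: fg_mu_ge0. Qed.

Lemma mu_s_le_sigma u : mu_s G u <= sigma u.
Proof.
rewrite /mu_s; set s := [seq _ | _ in _].
have [->|/seq_min_mem/imageP[v _ ->]] := eqVneq s [::].
  exact: fg_sigma_ge0.
exact: fg_mu_le_sigma.
Qed.

(** The strong neighbor [v] rules out the default value 0 of [mu_s], so [mu_s] is the weight of an
    actual pair of distinct vertices. *)
Lemma mu_s_ge u v (m : R) :
  (forall x y, x != y -> m <= mu x y) -> v \in Ns G u -> m <= mu_s G u.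
Proof.
move=> m_le uv; apply: seq_min_ge => [|_ /imageP[w uw ->]].
  apply/eqP => s0; have /= := image_f (mu u) uv.
  by rewrite s0.
by apply: m_le; apply: contraTneq uw => <-; apply: Ns_irr.
Qed.

Lemma SNRDF_weight_ge0 f : 0 <= SNRDF_weight G f.
Proof. by apply: sumr_ge0 => u _; rewrite mulr_ge0 ?ler0n ?mu_s_ge0. Qed.

Lemma gamma_snR_le f : is_SNRDF G f -> gamma_snR G <= SNRDF_weight G f.
Proof. by move=> Gf; apply/seq_min_le/imageP; exists f. Qed.

Lemma gamma_snR_ge (c : R) :
  (forall f, is_SNRDF G f -> c <= SNRDF_weight G f) -> c <= gamma_snR G.
Proof.
move=> c_le; apply: seq_min_ge => [|_ /imageP[f Gf ->]]; last exact: c_le.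
(* The constant 1 is vacuously an SNRDF, so the minimum is over a nonempty list. *)
pose f1 : {ffun V -> 'I_3} := [ffun=> inord 1].
have Gf1 : is_SNRDF G f1.
  by apply/forallP => u; rewrite ffunE inordK.
apply/eqP => s0; have := image_f (SNRDF_weight G) Gf1.
by rewrite s0.
Qed.

Definition star_SNRDF v : {ffun V -> 'I_3} :=
  [ffun u => if u == v then inord 2 else
             if u \in Ns G v then inord 0 else inord 1].

Lemma star_SNRDF_val v u :
  star_SNRDF v u = (if u == v then 2 else u \notin Ns G v)%N :> nat.
Proof. by rewrite ffunE; case: eqP => _; [|case: ifP => _]; rewrite inordK. Qed.

Lemma star_SNRDFP v : is_SNRDF G (star_SNRDF v).
Proof.
apply/forallP => u; apply/implyP; rewrite star_SNRDF_val.
case: (u == v) => //; case: (boolP (u \in Ns G v)) => // uv _.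
by apply/existsP; exists v; rewrite -Ns_sym uv star_SNRDF_val eqxx.
Qed.

Lemma star_SNRDF_weight_le v :
  SNRDF_weight G (star_SNRDF v) <= fg_order G - (d_SN G v - sigma v).
Proof.
(* With [sigma] in place of [mu_s] the weight equals the bound: [sigma u] is counted once, once more
   if [u = v], and once less if [u] is a strong neighbor of [v]. *)
have -> : fg_order G - (d_SN G v - sigma v)
        = \sum_u (star_SNRDF v u)%:R * sigma u.
  rewrite /d_SN big_mkcond /fg_order opprB addrA addrAC -sumrB.
  rewrite (bigD1 v) //= [RHS](bigD1 v) //= star_SNRDF_val eqxx.
  rewrite (negPf (Ns_irr v)) subr0 addrAC mulr_natl mulr2n; congr (_ + _).
  apply: eq_bigr => u /negPf uv; rewrite star_SNRDF_val uv.
  by case: ifP => _; rewrite ?subrr ?mul0r ?subr0 ?mul1r.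
by apply: ler_sum => u _; rewrite ler_wpM2l ?ler0n ?mu_s_le_sigma.
Qed.

Lemma SNRDF_weight_ge f u v (m : R) :
    0 < mu u v -> (forall x y, x != y -> m <= mu x y) -> is_SNRDF G f ->
  2 * m <= SNRDF_weight G f.
Proof.
move=> uv_gt0 m_le /forallP Gf.
have term_ge0 w : 0 <= (f w)%:R * mu_s G w by rewrite mulr_ge0 ?ler0n ?mu_s_ge0.
have [/existsP[x fx0]|/existsPn f_neq0] := boolP [exists x, f x == 0%N :> nat].
  have /existsP[y /andP[xy /eqP fy2]] := implyP (Gf x) fx0.
  (* The term at [y] alone suffices, since [x] is a strong neighbor of [y]. *)
  rewrite /SNRDF_weight (bigD1 y) //= fy2 -[leLHS]addr0 lerD ?sumr_ge0 //.
  by rewrite ler_wpM2l ?ler0n // (mu_s_ge (v := x)) // Ns_sym.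
have mu_s_le_term w : mu_s G w <= (f w)%:R * mu_s G w.
  by rewrite ler_peMl ?mu_s_ge0 // ler1n lt0n.
(* The maximal weight is positive because [mu u v] is, so it belongs to a strong edge. *)
case: (@arg_maxP _ R (V * V)%type (u, v) predT (fun e => mu e.1 e.2)) => //.
case=> a b _ /= ab_max.
have ab : b \in Ns G a.
  apply: max_edge_strong => [|x y]; last exact: (ab_max (x, y)).
  exact: lt_le_trans uv_gt0 (ab_max (u, v) isT).
have neq_ba : b != a by apply: contraTneq ab => ->; apply: Ns_irr.
rewrite /SNRDF_weight (bigD1 a) //= (bigD1 b) //= addrA.
rewrite -[leLHS]addr0 lerD ?sumr_ge0 // mulr_natl mulr2n.
by apply: lerD; apply: le_trans (mu_s_le_term _);
  [apply: (mu_s_ge (v := b)) | apply: (mu_s_ge (v := a)); rewrite // Ns_sym].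
Qed.

End FuzzyGraphTheory.

Theorem theorem3p5 (R : realType) (V : finType) (G : fuzzy_graph R V) :
  2 * seq_min [seq fg_mu G e.1 e.2 | e : V * V in [pred e | e.1 != e.2]]
    <= gamma_snR G
  /\ gamma_snR G
    <= fg_order G - seq_max [seq d_SN G v - fg_sigma G v | v : V].
Proof.
split.
  apply: gamma_snR_ge => f Gf; set s := [seq _ | _ in _].
  (* The nonpositive case includes [#|V| = 1], where [s] is empty and its minimum is 0 by
     default. *)
  have [m_le0|m_gt0] := leP (seq_min s) 0.
    by apply: le_trans (SNRDF_weight_ge0 G f); rewrite pmulr_rle0 ?ltr0n.
  have s0 : s != [::] by apply: contraTneq m_gt0 => ->; rewrite ltxx.
  have m_le x y : x != y -> seq_min s <= fg_mu G x y.
    by move=> xy; apply/seq_min_le/imageP; exists (x, y).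
  (* A pair attaining the positive minimum supplies the required edge. *)
  have /imageP[[u v] _ /= def_m] := seq_min_mem s0.
  by apply: (@SNRDF_weight_ge _ _ _ _ u v); rewrite -?def_m.
set s := [seq _ | _ in _].
have s0 : s != [::] by rewrite -size_eq0 size_image -lt0n (fg_nonempty G).
(* The function is built around a vertex [v] attaining the maximum. *)
have /imageP[v _ ->] := seq_max_mem s0.
exact: le_trans (gamma_snR_le (star_SNRDFP G v)) (star_SNRDF_weight_le G v).
Qed.
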